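(* Let $n\ge 2$, $k\ge 2$, $0\le s\le n-1$ and $\Lambda=(k-1)\Lambda_0+\Lambda_s$, a dominant integral weight of $\widehat{sl}(n)$. For $1\le j\le 5$ let $$W_j=\Big\{\Lambda-\ell_j\alpha_0-\sum_{i=1}^{n-1}(\ell_j-x_i)\alpha_i \ :\ (x_1,\dots,x_{n-1})\in\bigcup_{(x_1,x_{n-1})}M_j(s,n:x_1,x_{n-1})\Big\},$$ where the union is over all pairs of integers $(x_1,x_{n-1})$ with $x_1,x_{n-1}\ge\delta_{s,0}$ and $x_1+x_{n-1}\le k-1+\delta_{s,0}$, where the sets $M_j(s,n:x_1,x_{n-1})$ are those defined in the context, and where $\ell_j=\max_i x_i$ denotes the parameter $\ell_j$ attached to the tuple. Then $$\max(\Lambda)\cap P^+=\{\Lambda\}\cup W_1\cup W_2\cup W_3\cup W_4\cup W_5 .$$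
   Context: **Lie algebra.** $\widehat{sl}(n)$ is the affine Kac-Moody algebra of type $A^{(1)}_{n-1}$ with index set $\{0,1,\dots,n-1\}$, simple roots $\alpha_i$, simple coroots $h_i$, degree derivation $d$, fundamental weights $\Lambda_i$ ($\Lambda_i(h_j)=\delta_{ij}$, $\Lambda_i(d)=0$), null root $\delta=\alpha_0+\dots+\alpha_{n-1}$, weight lattice $P=\bigoplus_i\mathbb Z\Lambda_i\oplus\mathbb Z\delta$, and $P^+=\{\lambda\in P:\lambda(h_i)\ge0\ \forall i\}$. For $\Lambda\in P^+$, $V(\Lambda)$ is the integrable highest weight module. A weight $\mu$ of $V(\Lambda)$ is maximal if $\mu+\delta$ is not a weight of $V(\Lambda)$; $\max(\Lambda)$ is the set of maximal weights. $\delta_{s,0}$ is the Kronecker delta. **Sets $\mathcal I$, $\mathcal I^*$.** For $p\le q$, $\mathcal I(p,i_{\max}:q,i_{\min})$ is the set of tuples $(x_p,\dots,x_q)$ of nonnegative integers with $i_{\max}\ge x_i-x_{i-1}\ge i_{\min}$ for $p<i\le q$ and $x_i-x_{i-1}\ge x_{i+1}-x_i$ for $p<i<q$. $\mathcal I^*(p,i_{\min}:q,i_{\max})$ is the set of tuples $(x_p,\dots,x_q)$ whose reversal is of this type, i.e. $i_{\min}\le x_{i-1}-x_i\le i_{\max}$ for $p<i\le q$ and $x_{i-1}-x_i\le x_i-x_{i+1}$ for $p<i<q$. If $p=q$ the conditions are vacuous. **Sets $M_j$.** All tuples are $(n-1)$-tuples of nonnegative integers with the prescribed first entry $x_1$ and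 last entry $x_{n-1}$. Residues modulo a positive integer are least nonnegative residues. For $s=0$, $M_1=M_2=M_3=M_4=\emptyset$. For $1\le s\le n-1$: $M_1(s,n:x_1,x_{n-1})$ is the set of tuples $(x_1,\dots,x_{n-1})$ for which there are $1\le p\le q<s$ and integers $t_1,\ell_1$ such that $x_p=\dots=x_q=\ell_1$; $x_{s+1}=x_s-t_1$ (if $s<n-1$); $(x_1,\dots,x_p)\in\mathcal I(1,x_1:p,1)$; $(x_q,\dots,x_s)\in\mathcal I^*(q,1:s,t_1+1)$; $(x_s,\dots,x_{n-1})\in\mathcal I^*(s,t_1:n-1,x_{n-1})$; and - $x_{n-1}+n-s-1\le x_s\le\min\{x_1(s-1)-1,\ x_{n-1}(n-s)\}$; - if $s<n-1$: $\max\{1,\ x_s-x_{n-1}(n-s-1)\}\le t_1\le\left\lfloor\frac{x_s-x_{n-1}}{n-s-1}\right\rfloor$; if $s=n-1$: $t_1=x_{n-1}=x_s$ (in place of these bounds); - $\max\{x_1,x_s+1\}\le\ell_1\le\max\{a,\ a+m_1-(t_1+1)\}$, where $s(t_1+1)+x_s\equiv m_1\pmod{x_1+t_1+1}$ and $a=\frac{x_1((t_1+1)s+x_s-m_1)}{x_1+t_1+1}$. $M_2(s,n:x_1,x_{n-1})$ is the set of tuples for which there are $1\le p\le q<s<r\le n-1$ and an integer $\ell_2$ such that $x_p=\dots=x_q=\ell_2$; $x_s=x_{s+1}=\dots=x_r$; $(x_1,\dots,x_p)\in\mathcal I(1,x_1:p,1)$; $(x_q,\dots,x_s)\in\mathcal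 I^*(q,1:s,1)$; $(x_r,\dots,x_{n-1})\in\mathcal I^*(r,1:n-1,x_{n-1})$; and - $\max\{x_{n-1},\ x_1-s+1\}\le x_s\le\min\{x_{n-1}(n-s-1),\ x_1(s-1)-1\}$; - $\max\{x_1,x_s+1\}\le\ell_2\le\left\lfloor\frac{x_1}{x_1+1}(s+x_s)\right\rfloor$. $M_3(s,n:x_1,x_{n-1})$ (resp. $M_4(s,n:x_1,x_{n-1})$) is the set of tuples $(x_1,\dots,x_{n-1})$ whose reversal $(x_{n-1},\dots,x_1)$ belongs to $M_1(n-s,n:x_{n-1},x_1)$ (resp. $M_2(n-s,n:x_{n-1},x_1)$), with $\ell_3$ (resp. $\ell_4$) the corresponding parameter $\ell_1$ (resp. $\ell_2$) of the reversal. $M_5(s,n:x_1,x_{n-1})$ (for $0\le s\le n-1$) is the set of tuples for which there are $1\le q\le r\le n-1$ and an integer $\ell_5$ such that $x_q=\dots=x_r=\ell_5$; $(x_1,\dots,x_q)\in\mathcal I(1,x_1:q,1)$; $(x_r,\dots,x_{n-1})\in\mathcal I^*(r,1:n-1,x_{n-1})$; and - if $s>0$: $q\le s\le r$ and $\max\{x_1,x_{n-1}\}\le\ell_5\le\min\{sx_1,(n-s)x_{n-1}\}$; - if $s=0$ (where $x_1,x_{n-1}\ge1$): $\max\{x_1,x_{n-1}\}\le\ell_5\le\max\{b,\ b+m_5-x_{n-1}\}$, where $x_{n-1}n\equiv m_5\pmod{x_1+x_{n-1}}$ and $b=\frac{x_1(x_{n-1}n-m_5)}{x_1+x_{n-1}}$.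 *)

(* Defs.v *)
From HB Require Import structures.
From mathcomp Require Import all_boot all_order all_algebra.
From mathcomp Require Import boolp classical_sets.

Set Implicit Arguments.
Unset Strict Implicit.
Unset Printing Implicit Defensive.

Import Order.TTheory GRing.Theory Num.Theory.
Local Open Scope classical_set_scope.
Local Open Scope ring_scope.

HB.mixin Record Lmodule_isLie (K : fieldType) (L : Type)
    of GRing.Lmodule K L := {
  lie : L -> L -> L;
  lieDl : forall x y z, lie (x + y) z = lie x z + lie y z;
  lieZl : forall (c : K) x y, lie (c *: x) y = c *: lie x y;
  lieDr : forall x y z, lie x (y + z) = lie x y + lie x z;
  lieZr : forall (c : K) x y, lie x (c *: y) = c *: lie x y;
  liexx : forall x, lie x x = 0;
  lie_jacobi : forall x y z,
    lie x (lie y z) + lie y (lie z x) + lie z (lie x y) = 0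
}.

#[short(type="lieAlgType")]
HB.structure Definition LieAlgebra (K : fieldType) :=
  { L of Lmodule_isLie K L & GRing.Lmodule K L }.

Definition is_subspace (K : fieldType) (V : lmodType K) (A : set V) : Prop :=
  A 0 /\ forall (c : K) u v, A u -> A v -> A (c *: u + v).

Definition is_subalgebra (K : fieldType) (g : lieAlgType K) (A : set g) : Prop :=
  is_subspace A /\ forall x y, A x -> A y -> A (lie x y).

Definition is_ideal (K : fieldType) (g : lieAlgType K) (A : set g) : Prop :=
  is_subspace A /\ forall x y, A y -> A (lie x y).

(* Entry a_ij of the Cartan matrix of type A^(1)_(n-1), for i, j < n; the two
   neighbours of a vertex are counted with multiplicity, so that for n = 2 the
   off-diagonal entries are -2. *)
Definition cartan (n i j : nat) : int :=
  if i == j then 2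
  else - ((i.+1 == j %[mod n])%:Z + (j.+1 == i %[mod n])%:Z).

(* g is the Kac-Moody algebra of type A^(1)_(n-1) with Chevalley generators
   e_i, f_i, simple coroots h_i and degree derivation d, in the sense of
   Kac (Infinite dimensional Lie algebras, 1.2-1.4): the Cartan subalgebra
   spanned by the h_i and d has dimension n + 1 = 2 n - rank A, the defining
   relations hold, the generators generate g, and g has no nonzero ideal
   meeting the Cartan subalgebra trivially. *)
Record affine_sl (n : nat) (K : fieldType) (g : lieAlgType K)
    (e f h : 'I_n -> g) (d : g) : Prop := AffineSl {
  affine_sl_free : forall (c : 'I_n -> K) (c' : K),
    \sum_i c i *: h i + c' *: d = 0 -> (forall i, c i = 0) /\ c' = 0;
  affine_sl_hh : forall i j, lie (h i) (h j) = 0;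
  affine_sl_dh : forall i, lie d (h i) = 0;
  affine_sl_he : forall i j, lie (h i) (e j) = (cartan n i j)%:~R *: e j;
  affine_sl_hf : forall i j, lie (h i) (f j) = - (cartan n i j)%:~R *: f j;
  affine_sl_de : forall j, lie d (e j) = (j == 0 :> nat)%:R *: e j;
  affine_sl_df : forall j, lie d (f j) = - (j == 0 :> nat)%:R *: f j;
  affine_sl_ef : forall i j, lie (e i) (f j) = (i == j)%:R *: h i;
  affine_sl_gen : forall A : set g, is_subalgebra A ->
    (forall i, [/\ A (e i), A (f i) & A (h i)]) -> A d -> A = setT;
  affine_sl_ideal : forall A : set g, is_ideal A ->
    (forall (c : 'I_n -> K) (c' : K), A (\sum_i c i *: h i + c' *: d) ->
       \sum_i c i *: h i + c' *: d = 0) ->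
    A = [set 0]
}.

(* The weight lattice P; (c, m) stands for the sum of the c_i Lambda_i plus
   m delta, so that its values at h_i and d are c_i and m. *)
Definition weight (n : nat) : zmodType := ({ffun 'I_n -> int} * int)%type.

Definition fund_weight (n i : nat) : weight n :=
  ([ffun j : 'I_n => (j == i :> nat)%:Z], 0).

Definition simple_root (n i : nat) : weight n :=
  ([ffun j : 'I_n => cartan n j i], (i == 0)%:Z).

Definition null_root (n : nat) : weight n := \sum_(0 <= i < n) simple_root n i.

Definition dominant (n : nat) : set (weight n) :=
  [set mu : weight n | forall i : 'I_n, 0 <= mu.1 i].
Arguments dominant n : clear implicits.

Record is_lie_module (K : fieldType) (g : lieAlgType K) (V : lmodType K)
    (act : g -> V -> V) : Prop := IsLieModule {
  act_linearl : forall (c : K) x y v, act (c *: x + y) v = c *: act x v + act y v;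
  act_linearr : forall (c : K) x u v, act x (c *: u + v) = c *: act x u + act x v;
  act_lie : forall x y v, act (lie x y) v = act x (act y v) - act y (act x v)
}.

Section AffineModules.

Variables (n : nat) (K : fieldType) (g : lieAlgType K).
Variables (e f h : 'I_n -> g) (d : g).
Variables (V : lmodType K) (act : g -> V -> V).

Definition weight_space (mu : weight n) : set V :=
  [set v | (forall i, act (h i) v = (mu.1 i)%:~R *: v) /\
           act d v = (mu.2)%:~R *: v].

Definition is_weight (mu : weight n) : Prop :=
  exists2 v, v != 0 & weight_space mu v.

Definition max_weights : set (weight n) :=
  [set mu : weight n | is_weight mu /\ ~ is_weight (mu + null_root n)].

Definition is_submodule (A : set V) : Prop :=
  is_subspace A /\ forall x v, A v -> A (act x v).

Definition highest_weight_module (La : weight n) : Prop :=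
  exists v, [/\ v != 0, weight_space La v, forall i, act (e i) v = 0 &
    forall A : set V, is_submodule A -> A v -> A = setT].

(* Diagonalizability under the Cartan subalgebra is automatic for the highest
   weight modules to which this is applied. *)
Definition integrable_module : Prop :=
  forall i v, exists N : nat,
    iter N (act (e i)) v = 0 /\ iter N (act (f i)) v = 0.

(* V is the integrable highest weight module V(La). *)
Definition is_V (La : weight n) : Prop :=
  [/\ is_lie_module act, highest_weight_module La & integrable_module].

End AffineModules.

Section CalI.

Variable x : nat -> nat.

(* (x_p, ..., x_q) is in I(p, imax : q, imin). *)
Definition calI (p : nat) (imax : int) (q : nat) (imin : int) : Prop :=
  (forall i : nat, (p < i <= q)%N -> imin <= (x i)%:Z - (x i.-1)%:Z <= imax) /\
  (forall i : nat, (p < i < q)%N ->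
     (x i.+1)%:Z - (x i)%:Z <= (x i)%:Z - (x i.-1)%:Z).

(* (x_p, ..., x_q) is in I^*(p, imin : q, imax). *)
Definition calIs (p : nat) (imin : int) (q : nat) (imax : int) : Prop :=
  (forall i : nat, (p < i <= q)%N -> imin <= (x i.-1)%:Z - (x i)%:Z <= imax) /\
  (forall i : nat, (p < i < q)%N ->
     (x i.-1)%:Z - (x i)%:Z <= (x i)%:Z - (x i.+1)%:Z).

Definition const_on (p q : nat) (l : int) : Prop :=
  forall i : nat, (p <= i <= q)%N -> (x i)%:Z = l.

End CalI.

(* Tuples (x_1, ..., x_(n-1)) are numbered from 1. *)
Definition ent {n : nat} (x : n.-1.-tuple nat) (i : nat) : nat := nth 0%N x i.-1.

Definition with_ends {n : nat} (x : n.-1.-tuple nat) (x1 xl : nat) : Prop :=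
  ent x 1 = x1 /\ ent x n.-1 = xl.

(* In the sets below, xl is the prescribed last entry x_(n-1); the quotients
   defining a and b are exact by the choice of m1 and m5. *)

Definition M1 (n s x1 xl : nat) : set (n.-1.-tuple nat) :=
  [set x : n.-1.-tuple nat | with_ends x x1 xl /\ (1 <= s <= n.-1)%N /\
    exists (p q : nat) (t1 l1 : int),
    let xs : int := ent x s in
    let m1 := ((s%:Z * (t1 + 1) + xs) %% (x1%:Z + t1 + 1))%Z in
    let a := ((x1%:Z * ((t1 + 1) * s%:Z + xs - m1)) %/ (x1%:Z + t1 + 1))%Z in
    [/\ (1 <= p <= q)%N && (q < s)%N,
        const_on (ent x) p q l1,
        ((s < n.-1)%N -> (ent x s.+1)%:Z = xs - t1),
        [/\ calI (ent x) 1 x1 p 1,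
            calIs (ent x) q 1 s (t1 + 1) &
            calIs (ent x) s t1 n.-1 xl] &
        [/\ xl%:Z + n%:Z - s%:Z - 1 <= xs
              <= Num.min (x1%:Z * (s%:Z - 1) - 1) (xl%:Z * (n%:Z - s%:Z)),
            ((s < n.-1)%N ->
              Num.max 1 (xs - xl%:Z * (n%:Z - s%:Z - 1)) <= t1
                <= ((xs - xl%:Z) %/ (n%:Z - s%:Z - 1))%Z),
            (s = n.-1 -> t1 = xl%:Z /\ t1 = xs) &
            Num.max x1%:Z (xs + 1) <= l1 <= Num.max a (a + m1 - (t1 + 1))]]].
Arguments M1 n s x1 xl : clear implicits.

Definition M2 (n s x1 xl : nat) : set (n.-1.-tuple nat) :=
  [set x : n.-1.-tuple nat | with_ends x x1 xl /\ (1 <= s <= n.-1)%N /\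
    exists (p q r : nat) (l2 : int),
    let xs : int := ent x s in
    [/\ (1 <= p <= q)%N && (q < s)%N && (s < r <= n.-1)%N,
        const_on (ent x) p q l2,
        const_on (ent x) s r xs,
        [/\ calI (ent x) 1 x1 p 1,
            calIs (ent x) q 1 s 1 &
            calIs (ent x) r 1 n.-1 xl] &
        Num.max xl%:Z (x1%:Z - s%:Z + 1) <= xs
          <= Num.min (xl%:Z * (n%:Z - s%:Z - 1)) (x1%:Z * (s%:Z - 1) - 1) /\
        Num.max x1%:Z (xs + 1) <= l2
          <= ((x1%:Z * (s%:Z + xs)) %/ (x1%:Z + 1))%Z]].
Arguments M2 n s x1 xl : clear implicits.

Definition M3 (n s x1 xl : nat) : set (n.-1.-tuple nat) :=
  [set x : n.-1.-tuple nat | (1 <= s <= n.-1)%N /\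
     M1 n (n - s) xl x1 [tuple of rev x]].
Arguments M3 n s x1 xl : clear implicits.

Definition M4 (n s x1 xl : nat) : set (n.-1.-tuple nat) :=
  [set x : n.-1.-tuple nat | (1 <= s <= n.-1)%N /\
     M2 n (n - s) xl x1 [tuple of rev x]].
Arguments M4 n s x1 xl : clear implicits.

Definition M5 (n s x1 xl : nat) : set (n.-1.-tuple nat) :=
  [set x : n.-1.-tuple nat | with_ends x x1 xl /\ (s <= n.-1)%N /\
    exists (q r : nat) (l5 : int),
    let m5 := ((xl%:Z * n%:Z) %% (x1%:Z + xl%:Z))%Z in
    let b := ((x1%:Z * (xl%:Z * n%:Z - m5)) %/ (x1%:Z + xl%:Z))%Z in
    [/\ (1 <= q <= r)%N && (r <= n.-1)%N,
        const_on (ent x) q r l5,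
        calI (ent x) 1 x1 q 1 /\ calIs (ent x) r 1 n.-1 xl,
        ((0 < s)%N -> (q <= s <= r)%N /\
           Num.max x1%:Z xl%:Z <= l5
             <= Num.min (s%:Z * x1%:Z) ((n%:Z - s%:Z) * xl%:Z)) &
        (s = 0%N -> (0 < x1)%N /\ (0 < xl)%N /\
           Num.max x1%:Z xl%:Z <= l5 <= Num.max b (b + m5 - xl%:Z))]].
Arguments M5 n s x1 xl : clear implicits.

(* Lambda = (k - 1) Lambda_0 + Lambda_s. *)
Definition Lambda (n k s : nat) : weight n :=
  fund_weight n 0 *+ k.-1 + fund_weight n s.

Definition end_pairs (k s : nat) : set (nat * nat) :=
  [set y | [/\ ((s == 0) <= y.1)%N, ((s == 0) <= y.2)%N &
              (y.1 + y.2 <= k.-1 + (s == 0))%N]].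

Definition tuple_weight {n : nat} (k s : nat) (x : n.-1.-tuple nat) : weight n :=
  let l := (\max_(y <- x) y)%N in
  Lambda n k s - simple_root n 0 *~ l%:Z
    - \sum_(1 <= i < n) simple_root n i *~ (l%:Z - (ent x i)%:Z).

(* The set W_j attached to the family M = M_j(s, n : -, -). *)
Definition W {n : nat} (k s : nat) (M : nat -> nat -> set (n.-1.-tuple nat)) :
    set (weight n) :=
  [set tuple_weight k s x | x in \bigcup_(y in end_pairs k s) M y.1 y.2].

(* Main.v *)
Require Import Defs.
From HB Require Import structures.
From mathcomp Require Import all_boot all_order all_algebra.
From mathcomp Require Import boolp classical_sets zify.

Set Implicit Arguments.
Unset Strict Implicit.
Unset Printing Implicit Defensive.

Import Order.TTheory GRing.Theory Num.Theory.
Local Open Scope classical_set_scope.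
Local Open Scope ring_scope.

(* Writing a weight as [Lambda - sum_i m_i alpha_i] and [x_i = m_0 - m_i], so
   that [x_0 = x_n = 0], dominance says that [x] is concave on [0, n] except
   that its slope may increase by 1 at [s], together with a bound on
   [x_1 + x_(n-1)]. A dominant weight lying in [Lambda - Q_+] is a weight of
   V(Lambda) (Kac, Proposition 11.2), so maximality means [min_i m_i = 0], that
   is, [m_0 = max_i x_i].
   An almost concave [x] is concave (M5), or its maximum lies strictly before [s]
   (M1 or M2, according to whether the slope after [s] is negative or 0), or
   strictly after [s] (M3, M4, by reversal). The upper bounds on the maximum come
   from a line of slope [x_1] up to its position [p] and a line of slope [-T]
   after it, optimized over integers [p]. *)

(** * Concave integer sequences *)

Definition concave_on (X : nat -> int) (a b : nat) : Prop :=
  forall i : nat, (a < i < b)%N -> X i.+1 - X i <= X i - X i.-1.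

Lemma incr_le (X : nat -> int) (a b : nat) (c : int) :
    (forall i : nat, (a < i <= b)%N -> X i - X i.-1 <= c) -> (a <= b)%N ->
  X b - X a <= c * (b%:Z - a%:Z).
Proof.
elim: b => [|b IHb] hX hab.
  by (have -> : a = 0%N by lia); rewrite !subrr mulr0.
have [ab|ba] := leqP a b; last first.
  by (have -> : a = b.+1 by lia); rewrite !subrr mulr0.
have hX' i : (a < i <= b)%N -> X i - X i.-1 <= c by move=> hi; apply: hX; lia.
have := IHb hX' ab.
have := hX b.+1 ltac:(lia).
have -> : c * (b.+1%:Z - a%:Z) = c * (b%:Z - a%:Z) + c.
  by rewrite intS; lia.
by rewrite /=; lia.
Qed.

Lemma incr_ge (X : nat -> int) (a b : nat) (c : int) :
    (forall i : nat, (a < i <= b)%N -> c <= X i - X i.-1) -> (a <= b)%N ->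
  c * (b%:Z - a%:Z) <= X b - X a.
Proof.
move=> hX hab.
have hN i : (a < i <= b)%N -> - X i - - X i.-1 <= - c by move=> /hX; lia.
have := incr_le hN hab.
lia.
Qed.

Lemma incr_anti (X : nat -> int) (a b i j : nat) :
    concave_on X a b -> (a < i)%N -> (i <= j)%N -> (j <= b)%N ->
  X j - X j.-1 <= X i - X i.-1.
Proof.
move=> hX hi; elim: j => [|j IHj] ij jb; first by lia.
have [ij'|ji] := leqP i j; last by (have -> : i = j.+1 by lia).
by have := IHj ij' (ltnW jb); have := hX j ltac:(lia); rewrite /=; lia.
Qed.

Lemma concave_sub (X : nat -> int) (a b a' b' : nat) :
    concave_on X a b -> (a <= a')%N -> (b' <= b)%N -> concave_on X a' b'.
Proof. by move=> hX ? ? i hi; apply: hX; lia. Qed.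

Lemma concave_cat (X : nat -> int) (a b c : nat) :
    concave_on X a b -> concave_on X b c ->
    ((a < b < c)%N -> X b.+1 - X b <= X b - X b.-1) ->
  concave_on X a c.
Proof.
move=> h1 h2 h3 i hi; case: (ltngtP i b) => ib; [apply: h1|apply: h2|subst i; apply: h3]; lia.
Qed.

Lemma concave_const (X : nat -> int) (p q : nat) (l : int) :
    (forall i : nat, (p <= i <= q)%N -> X i = l) -> concave_on X p q.
Proof. by move=> h i hi; rewrite !h; lia. Qed.

(** Nonzero integer slopes are at least 1 in absolute value, so decreasing slopes split into a rise,
    a plateau from [p] to [q] and a fall. In the induction, a last slope above -1 forces the earlier
    fall to be empty, and a positive one also forces the earlier plateau to be a point. *)
Lemma unimodal (X : nat -> int) (a b : nat) :
    concave_on X a b -> (a <= b)%N ->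
  exists p q : nat,
    [/\ (a <= p <= q)%N && (q <= b)%N,
        (forall i : nat, (a < i <= p)%N -> 1 <= X i - X i.-1),
        (forall i : nat, (p <= i <= q)%N -> X i = X p) &
        (forall i : nat, (q < i <= b)%N -> X i - X i.-1 <= -1)].
Proof.
elim: b => [|b IHb] hX hab.
  exists 0%N, 0%N; split; try by [lia | move=> i hi; lia].
  by move=> i hi; have -> : i = 0%N by lia.
have [ab|ba] := leqP a b; last first.
  exists a, a; split; try by [lia | move=> i hi; lia].
  by move=> i hi; have -> : i = a by lia.
have [p [q [hpq hup hcst hdn]]] := IHb (concave_sub hX (leqnn a) (leqnSn b)) ab.
have hlast : (q < b)%N -> X b.+1 - X b <= -1.
  by move=> qb; have := hdn b ltac:(lia); have := hX b ltac:(lia); rewrite /=; lia.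
have [le1|gt1] := lerP (X b.+1 - X b) (-1).
  exists p, q; split=> //; first by lia.
  move=> i hi; have [ib|ib] := leqP i b; first by apply: hdn; lia.
  by (have -> : i = b.+1 by lia).
have qb : q = b by apply/eqP; apply/negP => /negP ?; have := hlast ltac:(lia); lia.
subst q.
have [e0|ne0] := eqVneq (X b.+1) (X b).
  exists p, b.+1; split=> //; try by [lia | move=> i hi; lia].
  move=> i hi; have [ib|ib] := leqP i b; first by apply: hcst; lia.
  by have -> : i = b.+1; [lia | rewrite e0; apply: hcst; lia].
have pb : p = b.
  apply/eqP; apply/negP => /negP np; have := hX b ltac:(lia).
  have := hcst b.-1 ltac:(lia); have := hcst b ltac:(lia); lia.
subst p; exists b.+1, b.+1; split; try by [lia | move=> i hi; lia].
  move=> i hi; have [ib|ib] := leqP i b; first by apply: hup; lia.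
  by have -> : i = b.+1; [lia | rewrite /=; lia].
by move=> i hi; have -> : i = b.+1 by lia.
Qed.

Lemma concave_ge0 (X : nat -> int) (a b : nat) :
    concave_on X a b -> (a <= b)%N -> 0 <= X a -> 0 <= X b ->
  forall i : nat, (a <= i <= b)%N -> 0 <= X i.
Proof.
move=> hX ab Xa Xb i hi; have [p [q [hpq hup hcst hdn]]] := unimodal hX ab.
have [ip|pi] := leqP i p.
  have h j : (a < j <= i)%N -> 0 <= X j - X j.-1 by move=> hj; have := hup j ltac:(lia); lia.
  by have := incr_ge h ltac:(lia); lia.
have h j : (i < j <= b)%N -> X j - X j.-1 <= 0.
  move=> hj; have [jq|qj] := leqP j q; first by rewrite !hcst; lia.
  by have := hdn j ltac:(lia); lia.
by have := incr_le h ltac:(lia); lia.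
Qed.

(* A negative value at the kink [s] would force the slope to jump by at least 2. *)
Lemma almost_concave_ge0 (X : nat -> int) (n s : nat) : (s < n)%N ->
    X 0%N = 0 -> X n = 0 ->
    (forall i : nat, (0 < i < n)%N -> X i.+1 - X i <= X i - X i.-1 + (i == s)%:Z) ->
  forall i : nat, (i <= n)%N -> 0 <= X i.
Proof.
move=> sn X0 Xn hX.
have c1 : concave_on X 0 s by move=> i hi; have := hX i ltac:(lia); case: eqP; lia.
have c2 : concave_on X s n by move=> i hi; have := hX i ltac:(lia); case: eqP; lia.
have Xs : 0 <= X s.
  have [->|s0] := posnP s; first by rewrite X0.
  rewrite leNgt; apply/negP => Xs.
  have := hX s ltac:(lia); rewrite eqxx.
  have [h1|h1] := lerP 0 (X s - X s.-1).
    have h i : (0 < i <= s)%N -> 0 <= X i - X i.-1.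
      by move=> hi; have := incr_anti c1 (_ : 0 < i)%N (_ : i <= s)%N (leqnn s); lia.
    by have := incr_ge h (leq0n s); lia.
  have [h2|h2] := lerP (X s.+1 - X s) 0; last by lia.
  have h i : (s < i <= n)%N -> X i - X i.-1 <= 0.
    by move=> hi; have := incr_anti c2 (ltnSn s) (_ : s < i)%N (_ : i <= n)%N; rewrite /=; lia.
  by have := incr_le h (ltnW sn); lia.
move=> i hi; have [is_|si] := leqP i s.
  by apply: (concave_ge0 c1) => //; rewrite ?X0.
by apply: (concave_ge0 c2) => //; rewrite ?Xn //; lia.
Qed.

(* With [N = c (x + T) + m] the lines [x p] and [N - T p] cross between [p = c]
   and [p = c + 1], where the minimum of the two is [a] and [a + m - T]. *)
Lemma peak_bound (x T N l : int) (p : nat) (m := (N %% (x + T))%Z)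
    (a := ((x * (N - m)) %/ (x + T))%Z) :
    0 <= x -> 0 <= T -> 0 < x + T -> l <= x * p%:Z -> l <= N - T * p%:Z ->
  l <= Num.max a (a + m - T).
Proof.
move=> x0 T0 d0 l1 l2.
have hN : N - m = (N %/ (x + T))%Z * (x + T).
  by apply/eqP; rewrite subr_eq; apply/eqP; exact: divz_eq.
set c := (N %/ (x + T))%Z in hN.
have ha : a = x * c by rewrite /a hN mulrA mulzK // gt_eqF.
clearbody a m c; subst a.
rewrite le_max; apply/orP; have [pc|cp] := lerP p%:Z c; [left|right]; nia.
Qed.

(** * Almost concave tuples and the sets M_j *)

Section Tuples.

Variable n : nat.
Implicit Type x : n.-1.-tuple nat.

(* [ext x] adds the boundary values [x_0 = x_n = 0]; note that [ent x 0] is a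
   junk value, namely [ent x 1]. *)
Definition ext x (i : nat) : int := if i == 0%N then 0 else (ent x i)%:Z.

Lemma ext0 x : ext x 0 = 0. Proof. by []. Qed.

Lemma ext_n x : ext x n = 0.
(* Position [n.-1] is past the end of the tuple, so [nth] returns its default 0. *)
Proof. by rewrite /ext /ent nth_default ?size_tuple //; case: eqP. Qed.

Lemma ext_ge0 x i : 0 <= ext x i.
Proof. by rewrite /ext; case: eqP. Qed.

Lemma entE x i : (0 < i)%N -> (ent x i)%:Z = ext x i.
Proof. by rewrite /ext; case: i. Qed.

Lemma ext_rev x i : (i <= n)%N -> ext [tuple of rev x] i = ext x (n - i).
Proof.
move=> hi; have [->|i0] := posnP i; first by rewrite subn0 ext_n.
have [->|ni] := eqVneq i n; first by rewrite subnn ext_n.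
rewrite -!entE ?subn_gt0 //; last by lia.
rewrite /ent /= nth_rev size_tuple; last by lia.
by congr (nth _ _ _)%:Z; lia.
Qed.

(** For [0 < i < n] the inequality expresses that the corresponding weight is nonnegative at [h_i];
    the Kronecker term is the contribution of [Lambda_s]. *)
Definition almost_concave (s : nat) x : Prop := forall i : nat, (0 < i < n)%N ->
  ext x i.+1 - ext x i <= ext x i - ext x i.-1 + (i == s)%:Z.

Lemma rev_tupleK x : [tuple of rev [tuple of rev x]] = x.
Proof. by apply: val_inj; rewrite /= revK. Qed.

Lemma almost_concave_rev s x : (s <= n)%N -> almost_concave s x -> almost_concave (n - s) [tuple of rev x].
Proof.
move=> sn hx i hi; have := hx (n - i)%N ltac:(lia).
rewrite !ext_rev; try lia.
have -> : (n - i.-1 = (n - i).+1)%N by lia.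
have -> : (n - i.+1 = (n - i).-1)%N by lia.
have -> : ((n - i)%N == s) = (i == (n - s)%N) by apply/eqP/eqP; lia.
lia.
Qed.

Lemma almost_concaveP s x : almost_concave s x <->
  [/\ concave_on (ext x) 0 (minn s n), concave_on (ext x) s n &
      (0 < s < n)%N -> ext x s.+1 - ext x s <= ext x s - ext x s.-1 + 1].
Proof.
split=> [hx|[h1 h2 h3] i hi].
  split=> [i hi|i hi|hs].
  - by have := hx i ltac:(lia); case: eqP => ?; lia.
  - by have := hx i ltac:(lia); case: eqP => ?; lia.
  - by have := hx s hs; rewrite eqxx.
have [ei|si] := eqVneq i s; first by subst i; apply: h3; lia.
by rewrite addr0; have [?|?] := ltnP i s; [apply: h1|apply: h2]; lia.
Qed.

(** * Members of the sets M_j are almost concave *)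

Lemma concave_almost_concave s x : concave_on (ext x) 0 n -> almost_concave s x.
Proof. by move=> h i hi; have := h i hi; lia. Qed.

(** The bound [x_1] on the increments extends concavity to position 1, because [x_1 - x_0 = x_1]. *)
Lemma calI_concave x p : calI (ent x) 1 (ent x 1) p 1 -> (1 <= p)%N ->
  concave_on (ext x) 0 p /\ 0 <= ext x p - ext x p.-1.
Proof.
move=> [h1 h2] p1; split.
  move=> i hi; have [i1|i1] := leqP i 1.
    have ei : i = 1%N by lia.
    subst i; have := h1 2%N ltac:(lia); rewrite !entE //= ext0; lia.
  have := h2 i ltac:(lia); rewrite !entE //; lia.
have [i1|i1] := leqP p 1.
  have -> : p = 1%N by lia.
  by rewrite ext0 subr0 ext_ge0.
have := h1 p ltac:(lia); rewrite !entE //; lia.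
Qed.

Lemma calIs_ext x q s t t' : calIs (ent x) q t s t' -> (1 <= q)%N ->
  concave_on (ext x) q s /\
  forall i, (q < i <= s)%N -> - t' <= ext x i - ext x i.-1 <= - t.
Proof.
move=> [h1 h2] q1; split=> i hi.
  have := h2 i ltac:(lia); rewrite !entE //; lia.
have := h1 i ltac:(lia); rewrite !entE //; lia.
Qed.

(** The bound [x_(n-1)] on the drops extends concavity to position [n - 1], because [x_n = 0]. *)
Lemma calIs_concave x r t :
    calIs (ent x) r t n.-1 (ent x n.-1) -> (1 <= r <= n.-1)%N ->
  concave_on (ext x) r n /\
  forall i, (r < i < n)%N -> ext x i - ext x i.-1 <= - t.
Proof.
move=> /calIs_ext h r1; have [|h1 h2] := h; first lia.
split=> i hi; last by have := h2 i ltac:(lia); lia.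
have [ei|ni] := eqVneq i n.-1; last by apply: h1; lia.
have -> : i.+1 = n by lia.
rewrite ext_n; have := h2 i ltac:(lia); rewrite ei entE; lia.
Qed.

(** Rise, plateau and fall glue to a concave piece up to [s]. At [s] the slope goes from at least
    [-(t1 + 1)] to [-t1], so it grows by at most 1; for [s = n - 1] the slope [-t1] is that of the
    step to [x_n = 0]. *)
Lemma M1_almost_concave s x (x1 xl : nat) : M1 n s x1 xl x -> almost_concave s x.
Proof.
move=> [[e1 e2] [hs [p [q [t1 [l1 [hpq hc ht [hI hI1 hI2] [hb _ ht' _]]]]]]]].
rewrite -e1 in hI; rewrite -e2 in hI2.
have [|c1 d1] := calI_concave hI; first by lia.
have [|c2 d2] := calIs_ext hI1; first by lia.
have [|c3 d3] := calIs_concave hI2; first by lia.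
have c4 : concave_on (ext x) p q.
  by apply: (@concave_const _ _ _ l1) => i hi; rewrite -entE ?hc //; lia.
have cst i : (p <= i <= q)%N -> ext x i = l1 by move=> hi; rewrite -entE ?hc //; lia.
apply/almost_concaveP; split=> [||_].
- rewrite (minn_idPl _); last by lia.
  apply: (concave_cat c1); first apply: (concave_cat c4 c2) => hi.
  + have := d2 q.+1 ltac:(lia); have := cst q ltac:(lia); have := cst q.-1 ltac:(lia).
    by rewrite /=; lia.
  + move=> hi; have [pq|pq] := ltnP p q.
      have := cst p ltac:(lia); have := cst p.+1 ltac:(lia); lia.
    have -> : p = q by lia.
    have := d2 q.+1 ltac:(lia); have -> : q = p by lia.
    by rewrite /=; lia.
- exact: c3.
- have := d2 s ltac:(lia).
  have [sn|sn] := ltnP s n.-1; first by have := ht sn; rewrite !entE; lia.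
  have es : s = n.-1 by lia.
  have -> : s.+1 = n by lia.
  by rewrite ext_n; have := ht' es; rewrite entE; lia.
Qed.

(** All slopes between [q] and [s] equal -1 and the second plateau has slope 0, so the slope grows
    by exactly 1 at [s]. *)
Lemma M2_almost_concave s x (x1 xl : nat) : M2 n s x1 xl x -> almost_concave s x.
Proof.
move=> [[e1 e2] [hs [p [q [r [l2 [hpq hc hc' [hI hI1 hI2] _]]]]]]].
rewrite -e1 in hI; rewrite -e2 in hI2.
have [|c1 d1] := calI_concave hI; first by lia.
have [|c2 d2] := calIs_ext hI1; first by lia.
have [|c3 d3] := calIs_concave hI2; first by lia.
have cst i : (p <= i <= q)%N -> ext x i = l2 by move=> hi; rewrite -entE ?hc //; lia.
have cst' i : (s <= i <= r)%N -> ext x i = ext x s by move=> hi; rewrite -!entE ?hc' //; lia.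
have c4 := concave_const cst.
have c5 := concave_const cst'.
apply/almost_concaveP; split=> [||_].
- rewrite (minn_idPl _); last by lia.
  apply: (concave_cat c1); first apply: (concave_cat c4 c2) => hi.
  + have := d2 q.+1 ltac:(lia); have := cst q ltac:(lia); have := cst q.-1 ltac:(lia).
    by rewrite /=; lia.
  + move=> hi; have [pq|pq] := ltnP p q.
      have := cst p ltac:(lia); have := cst p.+1 ltac:(lia); lia.
    have -> : p = q by lia.
    have := d2 q.+1 ltac:(lia); have -> : q = p by lia.
    by rewrite /=; lia.
- apply: (concave_cat c5 c3) => hi; have := cst' r ltac:(lia); have := cst' r.-1 ltac:(lia).
  have [rn|rn] := ltnP r n.-1; first by have := d3 r.+1 ltac:(lia); rewrite /=; lia.
  have -> : r.+1 = n by lia.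
  by rewrite ext_n; have := ext_ge0 x r; lia.
- have := d2 s ltac:(lia); have := cst' s.+1 ltac:(lia); lia.
Qed.

Lemma M3_almost_concave s x (x1 xl : nat) : M3 n s x1 xl x -> almost_concave s x.
Proof.
move=> [hs /M1_almost_concave /almost_concave_rev]; rewrite rev_tupleK subKn; first by apply; lia.
by lia.
Qed.

Lemma M4_almost_concave s x (x1 xl : nat) : M4 n s x1 xl x -> almost_concave s x.
Proof.
move=> [hs /M2_almost_concave /almost_concave_rev]; rewrite rev_tupleK subKn; first by apply; lia.
by lia.
Qed.

Lemma M5_almost_concave s x (x1 xl : nat) : M5 n s x1 xl x -> almost_concave s x.
Proof.
move=> [[e1 e2] [hs [q [r [l [hqr hc [hI hI1] _ _]]]]]].
rewrite -e1 in hI; rewrite -e2 in hI1.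
have [|c1 d1] := calI_concave hI; first by lia.
have [|c3 d3] := calIs_concave hI1; first by lia.
have cst i : (q <= i <= r)%N -> ext x i = l by move=> hi; rewrite -entE ?hc //; lia.
have c4 := concave_const cst.
apply: concave_almost_concave; apply: (concave_cat c1); first apply: (concave_cat c4 c3) => hi.
  have := cst r ltac:(lia); have := cst r.-1 ltac:(lia).
  have [rn|rn] := ltnP r n.-1; first by have := d3 r.+1 ltac:(lia); rewrite /=; lia.
  have -> : r.+1 = n by lia.
  by rewrite ext_n; have := ext_ge0 x r; lia.
move=> hi; have [qr|rq] := ltnP q r.
  have := cst q ltac:(lia); have := cst q.+1 ltac:(lia); lia.
have eq : q = r by lia.
have [rn|rn] := ltnP r n.-1; first by have := d3 r.+1 ltac:(lia); rewrite /= -eq; lia.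
have -> : q.+1 = n by lia.
by rewrite ext_n; have := ext_ge0 x q; lia.
Qed.

(** * Almost concave tuples belong to some M_j *)

Lemma calI_of_concave x p : (1 <= p)%N -> concave_on (ext x) 0 p ->
    (forall i : nat, (0 < i <= p)%N -> 1 <= ext x i - ext x i.-1) ->
  calI (ent x) 1 (ent x 1) p 1.
Proof.
move=> p1 hc hi; split=> i ii; rewrite !entE; try lia.
- have := hi i ltac:(lia); have := incr_anti hc (ltn0Sn 0) (_ : 1 <= i)%N (_ : i <= p)%N.
  by rewrite ext0; lia.
- by have := hc i ltac:(lia).
Qed.

Lemma calIs_of_concave x q s (t t' : int) : (1 <= q)%N -> concave_on (ext x) q s ->
    (forall i : nat, (q < i <= s)%N -> - t' <= ext x i - ext x i.-1 <= - t) ->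
  calIs (ent x) q t s t'.
Proof.
move=> q1 hc hi; split=> i ii; rewrite !entE; try lia.
- by have := hi i ltac:(lia); lia.
- by have := hc i ltac:(lia); lia.
Qed.

(** By concavity up to [n], every drop is at most the last one, which is [x_(n-1)] since
    [x_n = 0]. *)
Lemma calIs_last_of_concave x r (t : int) : (1 <= r <= n.-1)%N -> concave_on (ext x) r n ->
    (forall i : nat, (r < i < n)%N -> ext x i - ext x i.-1 <= - t) ->
  calIs (ent x) r t n.-1 (ent x n.-1).
Proof.
move=> r1 hc hi; apply: calIs_of_concave; first lia.
  by apply: concave_sub hc _ _; lia.
move=> i ii; have := hi i ltac:(lia).
have := incr_anti hc (_ : r < i)%N (_ : i <= n)%N (leqnn n).
by rewrite ext_n entE; lia.
Qed.

(** A positive entry keeps the plateau between 1 and [n - 1]. For [s > 0] the last hypothesis puts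
    [s] on the plateau, and the slope bounds [x_1] from the left and [-x_(n-1)] from the right are
    applied at [s]. For [s = 0] the position of the peak is free, and [peak_bound] is used
    instead. *)
Lemma concave_M5 s x : (s < n)%N -> concave_on (ext x) 0 n ->
    (exists i, 0 < ext x i) ->
    ((0 < s)%N -> ext x s.+1 <= ext x s /\ ext x s.-1 <= ext x s) ->
  M5 n s (ent x 1) (ent x n.-1) x.
Proof.
move=> sn hc [j hj] hs.
have [p [q [hpq hup hcst hdn]]] := unimodal hc (leq0n n).
have jn : (0 < j < n)%N.
  apply/negP => /negP jn; have [j0|j0] := posnP j; first by rewrite j0 ext0 in hj.
  move: hj; rewrite /ext /ent nth_default ?size_tuple; first by case: eqP.
  by lia.
have p0 : (0 < p)%N.
  have [p0|//] := posnP p; subst p.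
  have h i : (0 < i <= j)%N -> ext x i - ext x i.-1 <= 0.
    move=> ij; have [iq|qi] := leqP i q; last by have := hdn i ltac:(lia); lia.
    by rewrite !hcst //; lia.
  by have := incr_le h (leq0n j); rewrite ext0; lia.
have qn : (q < n)%N.
  have [//|qn] := ltnP q n; have {}qn : q = n by lia.
  subst q; have h i : (j < i <= n)%N -> 0 <= ext x i - ext x i.-1.
    move=> ij; have [ip|pi] := leqP i p; first by have := hup i ltac:(lia); lia.
    by rewrite !hcst //; lia.
  by have := incr_ge h ltac:(lia); rewrite ext_n; lia.
have hu1 i : (0 < i <= n)%N -> ext x i - ext x i.-1 <= ext x 1.
  by move=> hi; have := incr_anti hc (ltn0Sn 0) (_ : 1 <= i)%N (_ : i <= n)%N; rewrite ext0; lia.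
have hun i : (0 < i <= n)%N -> - ext x n.-1 <= ext x i - ext x i.-1.
  by move=> hi; have := incr_anti hc (_ : 0 < i)%N (_ : i <= n)%N (leqnn n); rewrite ext_n; lia.
have lp : ext x p <= ext x 1 * p%:Z.
  have h i : (0 < i <= p)%N -> ext x i - ext x i.-1 <= ext x 1 by move=> hi; apply: hu1; lia.
  by have := incr_le h (leq0n p); rewrite ext0; lia.
have lq : ext x p <= ext x n.-1 * (n%:Z - p%:Z).
  have h i : (p < i <= n)%N -> - ext x n.-1 <= ext x i - ext x i.-1 by move=> hi; apply: hun; lia.
  by have := incr_ge h ltac:(lia); rewrite ext_n; lia.
have g1 : ext x 1 <= ext x p.
  have h i : (1 < i <= p)%N -> 0 <= ext x i - ext x i.-1.
    by move=> hi; have := hup i ltac:(lia); lia.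
  by have := incr_ge h p0; lia.
have g2 : ext x n.-1 <= ext x p.
  rewrite -(hcst q ltac:(lia)).
  have h i : (q < i <= n.-1)%N -> ext x i - ext x i.-1 <= 0.
    by move=> hi; have := hdn i ltac:(lia); lia.
  by have := incr_le h ltac:(lia); lia.
split; first by [].
split; first lia.
exists p, q, (ext x p); split.
- lia.
- by move=> i hi; rewrite entE ?hcst; lia.
- split; [apply: calI_of_concave => //|apply: calIs_last_of_concave => //].
  + by apply: concave_sub hc _ _; lia.
  + lia.
  + by apply: concave_sub hc _ _; lia.
  + by move=> i hi; apply: hdn; lia.
- move=> s0; have [hs1 hs2] := hs s0.
  have sq : (p <= s <= q)%N.
    apply/andP; split; rewrite leqNgt; apply/negP => h.
      by have := hup s.+1 ltac:(lia); rewrite /=; lia.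
    by have := hdn s ltac:(lia); lia.
  split=> //; rewrite !entE; try lia.
  have es := hcst s sq.
  have h i : (0 < i <= s)%N -> ext x i - ext x i.-1 <= ext x 1 by move=> hi; apply: hu1; lia.
  have := incr_le h (leq0n s).
  have h' i : (s < i <= n)%N -> - ext x n.-1 <= ext x i - ext x i.-1 by move=> hi; apply: hun; lia.
  have := incr_ge h' ltac:(lia).
  by rewrite ext0 ext_n es; lia.
- move=> s0.
  have x1p : 1 <= ext x 1 by have := hup 1%N ltac:(lia); rewrite ext0; lia.
  have xnp : 1 <= ext x n.-1.
    by have := hdn n ltac:(lia); rewrite ext_n; lia.
  do 2 (split; first by rewrite -ltz_nat entE; lia).
  rewrite !entE; try lia.
  apply/andP; split; first lia.
  (* Here [T = x_(n-1)] and [N = n x_(n-1)]: the falling line vanishes at [n]. *)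
  by apply: (@peak_bound _ _ _ _ p); lia.
Qed.

(** A strict descent into [s] puts the plateau strictly before [s]. The drop [t] just after [s] is
    nonnegative, because the slope grows by at most 1 there, and for the same reason all drops
    before [s] are at most [t + 1]. M1 takes [t1 = t]; M2 is the case [t = 0], [s < n - 1]. *)
Lemma descent_M1_M2 s x : (0 < s < n)%N -> almost_concave s x -> ext x s < ext x s.-1 ->
  M1 n s (ent x 1) (ent x n.-1) x \/ M2 n s (ent x 1) (ent x n.-1) x.
Proof.
move=> hs /almost_concaveP[]; rewrite (minn_idPl _); last by lia.
move=> c1 c2 /(_ hs) c3 us.
have [p [q [hpq hup hcst hdn]]] := unimodal c1 (leq0n s).
have p0 : (0 < p)%N.
  have [p0|//] := posnP p; subst p.
  have h i : (0 < i <= s.-1)%N -> ext x i - ext x i.-1 <= 0.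
    move=> ij; have [iq|qi] := leqP i q; last by have := hdn i ltac:(lia); lia.
    by rewrite !hcst //; lia.
  by have := incr_le h (leq0n s.-1); have := ext_ge0 x s; rewrite ext0; lia.
have qs : (q < s)%N.
  have [//|sq] := ltnP q s; have [ps|sp] := ltnP p s.
    by move: us; rewrite !hcst; lia.
  by have := hup s ltac:(lia); lia.
have hu1 i : (0 < i <= s)%N -> ext x i - ext x i.-1 <= ext x 1.
  by move=> hi; have := incr_anti c1 (ltn0Sn 0) (_ : 1 <= i)%N (_ : i <= s)%N; rewrite ext0; lia.
have hun i : (s < i <= n)%N -> - ext x n.-1 <= ext x i - ext x i.-1.
  by move=> hi; have := incr_anti c2 (_ : s < i)%N (_ : i <= n)%N (leqnn n); rewrite ext_n; lia.
have hus i : (0 < i <= s)%N -> ext x s - ext x s.-1 <= ext x i - ext x i.-1.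
  by move=> hi; have := incr_anti c1 (_ : 0 < i)%N (_ : i <= s)%N (leqnn s); lia.
have hus1 i : (s < i <= n)%N -> ext x i - ext x i.-1 <= ext x s.+1 - ext x s.
  by move=> hi; have := incr_anti c2 (_ : s < s.+1)%N (_ : s.+1 <= i)%N (_ : i <= n)%N; rewrite /=; lia.
have lp : ext x p <= ext x 1 * p%:Z.
  have h i : (0 < i <= p)%N -> ext x i - ext x i.-1 <= ext x 1 by move=> hi; apply: hu1; lia.
  by have := incr_le h (leq0n p); rewrite ext0; lia.
have g1 : ext x 1 <= ext x p.
  have h i : (1 < i <= p)%N -> 0 <= ext x i - ext x i.-1.
    by move=> hi; have := hup i ltac:(lia); lia.
  by have := incr_ge h p0; lia.
have eq : ext x q = ext x p by apply: hcst; lia.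
have gs : ext x s < ext x p.
  have h i : (q < i <= s)%N -> ext x i - ext x i.-1 <= -1 by move=> hi; apply: hdn; lia.
  by have := incr_le h ltac:(lia); lia.
(* The first [s - 1] steps rise by at most [x_1] each, and the step into [s] drops by at least 1. *)
have bs : ext x s <= ext x 1 * (s%:Z - 1) - 1.
  have h i : (0 < i <= s.-1)%N -> ext x i - ext x i.-1 <= ext x 1 by move=> hi; apply: hu1; lia.
  by have := incr_le h (leq0n s.-1); rewrite ext0; (have -> : s.-1%:Z = s%:Z - 1 by lia); lia.
have bs1 : ext x s.+1 <= ext x n.-1 * (n%:Z - s%:Z - 1).
  have h i : (s.+1 < i <= n)%N -> - ext x n.-1 <= ext x i - ext x i.-1 by move=> hi; apply: hun; lia.
  by have := incr_ge h ltac:(lia); rewrite ext_n; (have -> : s.+1%:Z = s%:Z + 1 by lia); lia.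
have bs0 : ext x s <= ext x n.-1 * (n%:Z - s%:Z).
  have h i : (s < i <= n)%N -> - ext x n.-1 <= ext x i - ext x i.-1 by move=> hi; apply: hun; lia.
  by have := incr_ge h ltac:(lia); rewrite ext_n; lia.
have hI : calI (ent x) 1 (ent x 1) p 1.
  by apply: calI_of_concave => //; apply: concave_sub c1 _ _; lia.
(* Going back from [s] with drops at most [T] bounds the peak by the line of slope [-T] through
   [(s, x_s)]. *)
have lT (T : int) : ext x s.-1 - ext x s <= T -> ext x p <= T * s%:Z + ext x s - T * p%:Z.
  move=> hT.
  have h i : (p < i <= s)%N -> - T <= ext x i - ext x i.-1 by move=> hi; have := hus i ltac:(lia); lia.
  by have := incr_ge h ltac:(lia); lia.
set t : int := ext x s - ext x s.+1.
(* For [s = n - 1] the drop [t = x_s] may be 0, and the tuple still goes to M1. *)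
have [/andP[t0 sn]|ht] := boolP ((t == 0) && (s < n.-1)%N); [right|left].
  have est : ext x s.+1 = ext x s by move: t0; rewrite /t; lia.
  have [p' [q' [hpq' hup' hcst' hdn']]] := unimodal c2 ltac:(lia).
  have ep' : p' = s.
    apply/eqP; apply/negP => /negP ?; have := hup' s.+1 ltac:(lia); rewrite /=; lia.
  subst p'.
  have sq' : (s < q')%N.
    by rewrite ltnNge; apply/negP => ?; have := hdn' s.+1 ltac:(lia); rewrite /=; lia.
  split; first by [].
  split; first lia.
  (* When [x_s = 0] the plateau after [s] runs up to [n], so its end is cut at [n - 1]. *)
  exists p, q, (minn q' n.-1), (ext x p); split.
  - lia.
  - by move=> i hi; rewrite entE ?hcst; lia.
  - by move=> i hi; rewrite !entE ?hcst'; lia.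
  - split=> //; [apply: calIs_of_concave|apply: calIs_last_of_concave].
    + lia.
    + by apply: concave_sub c1 _ _; lia.
    + by move=> i hi; have := hdn i ltac:(lia); have := hus i ltac:(lia); lia.
    + lia.
    + by apply: concave_sub c2 _ _; lia.
    + by move=> i hi; apply: hdn'; lia.
  - rewrite !entE; try lia.
    have h i : (s < i <= n.-1)%N -> ext x i - ext x i.-1 <= 0.
      by move=> hi; have := hus1 i ltac:(lia); lia.
    have b1 := incr_le h ltac:(lia).
    have h' i : (q < i <= s)%N -> -1 <= ext x i - ext x i.-1.
      by move=> hi; have := hus i ltac:(lia); lia.
    have b2 := incr_ge h' ltac:(lia).
    split; first lia.
    apply/andP; split; first lia.
    (* Adding [x_1] times the bound [s + x_s - p] to the bound [x_1 p] eliminates [p]. *)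
    have := lT 1 ltac:(lia) => lt1.
    have := ler_wpM2l (ext_ge0 x 1) lt1.
    by rewrite lez_divRL; [lia | have := ext_ge0 x 1; lia].
have t1 : (s < n.-1)%N -> 1 <= t by move: ht; rewrite negb_and /t; lia.
have t0 : 0 <= t by rewrite /t; lia.
have te : s = n.-1 -> t = ext x s.
  move=> es; rewrite /t; have -> : s.+1 = n by lia.
  by rewrite ext_n subr0.
split; first by [].
split; first lia.
exists p, q, t, (ext x p); split.
- lia.
- by move=> i hi; rewrite entE ?hcst; lia.
- by move=> sn; rewrite !entE /t; lia.
- split=> //; [apply: calIs_of_concave|apply: calIs_last_of_concave].
  + lia.
  + by apply: concave_sub c1 _ _; lia.
  + by move=> i hi; have := hdn i ltac:(lia); have := hus i ltac:(lia); rewrite /t; lia.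
  + lia.
  + by apply: concave_sub c2 _ _; lia.
  + by move=> i hi; have := hus1 i ltac:(lia); rewrite /t; lia.
rewrite !entE; try lia.
have h i : (s < i <= n.-1)%N -> ext x i - ext x i.-1 <= - t.
  by move=> hi; have := hus1 i ltac:(lia); rewrite /t; lia.
have b1 := incr_le h ltac:(lia).
split.
- have [sn|sn] := ltnP s n.-1; first by have := t1 sn; nia.
  have es : s = n.-1 by lia.
  by rewrite -es; lia.
- move=> sn; have := t1 sn => t1'.
  rewrite lez_divRL; last by lia.
  by rewrite /t in b1 *; nia.
- by move=> es; rewrite te // -es.
- apply/andP; split; first lia.
  (* The goal is brought to the form of [peak_bound] with [T = t + 1] and [N = (t + 1) s + x_s]. *)
  have e1 : ext x 1 + t + 1 = ext x 1 + (t + 1) by lia.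
  rewrite e1 [s%:Z * _]mulrC.
  by apply: (@peak_bound _ _ _ _ p); have := ext_ge0 x 1; have := lT (t + 1); rewrite /t; lia.
Qed.

Definition all_M (s x1 xl : nat) : set (n.-1.-tuple nat) :=
  M1 n s x1 xl `|` M2 n s x1 xl `|` M3 n s x1 xl `|` M4 n s x1 xl `|` M5 n s x1 xl.

Lemma ent_rev_first x : (1 < n)%N -> ent [tuple of rev x] 1 = ent x n.-1.
Proof. by move=> n1; apply/eqP; rewrite -eqz_nat !entE ?ext_rev ?subn1 //; lia. Qed.

Lemma ent_rev_last x : (1 < n)%N -> ent [tuple of rev x] n.-1 = ent x 1.
Proof. by move=> n1; rewrite -ent_rev_first // rev_tupleK. Qed.

Lemma almost_concave_M s x : (1 < n)%N -> (s < n)%N -> almost_concave s x -> (exists i, 0 < ext x i) ->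
  all_M s (ent x 1) (ent x n.-1) x.
Proof.
move=> n1 sn hx x0; have [c1 c2 c3] := (almost_concaveP s x).1 hx.
rewrite (minn_idPl (ltnW sn)) in c1.
have [s0|s0] := posnP s.
  by right; apply: concave_M5 => //; [rewrite -s0|lia].
have [h|h] := ltrP (ext x s) (ext x s.-1).
  by case: (descent_M1_M2 _ hx h); [lia|do 4 left|do 3 left; right].
(* With no descent into [s] and no ascent out of it, the slope does not grow at [s] and [x] is
   concave. An ascent out of [s] becomes a descent into [n - s] after reversal. *)
have [h'|h'] := ltrP (ext x s) (ext x s.+1); last first.
  right; apply: concave_M5 => //.
  by apply: (concave_cat c1 c2); lia.
have hsr : (0 < n - s < n)%N by lia.
have := descent_M1_M2 hsr (almost_concave_rev (ltnW sn) hx).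
rewrite !ext_rev; try lia.
rewrite subKn; last by lia.
have -> : (n - (n - s).-1 = s.+1)%N by lia.
move=> /(_ h').
rewrite ent_rev_first // ent_rev_last // => -[h1|h1]; [do 2 left; right|left; right]; split=> //; lia.
Qed.

Lemma all_M_almost_concave s x (x1 xl : nat) : all_M s x1 xl x -> almost_concave s x.
Proof.
by move=> [[[[/M1_almost_concave|/M2_almost_concave]|/M3_almost_concave]|
  /M4_almost_concave]|/M5_almost_concave].
Qed.

Lemma all_M_ends s x (x1 xl : nat) : (1 < n)%N -> all_M s x1 xl x ->
  ent x 1 = x1 /\ ent x n.-1 = xl.
Proof.
move=> n1 h; case: h => [[[[[[]]|[[]]]|[_ [[]]]]|[_ [[]]]]|[[]]] //;
  by rewrite ent_rev_first // ent_rev_last.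
Qed.

(** This gives the lower bounds on the end entries in [end_pairs] for [s = 0], where only M5 is
    nonempty. *)
Lemma all_M0_ends_gt0 x (x1 xl : nat) : all_M 0 x1 xl x -> (0 < x1)%N /\ (0 < xl)%N.
Proof.
move=> [[[[[_ []]|[_ []]]|[]]|[]]|] //.
by move=> [_ [_ [q [r [l [_ _ _ _ /(_ erefl) [? [? _]]]]]]]].
Qed.

End Tuples.

(** * Weights of V(Lambda) *)

Lemma intr_char0_eq0 (K : fieldType) : [pchar K] =i pred0 ->
  forall z : int, (z%:~R == 0 :> K) = (z == 0).
Proof.
move=> /pcharf0P hK [m|m]; first exact: hK.
by rewrite NegzE mulrNz !oppr_eq0; exact: hK.
Qed.

(** * The Cartan matrix as a Laplacian on the cycle *)

Section Cycle.

Variables (n : nat) (n_gt1 : (1 < n)%N).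

Definition cyc_succ (i : nat) : nat := (i.+1 %% n)%N.
Definition cyc_pred (i : nat) : nat := ((i + n.-1) %% n)%N.

Lemma cyc_succ_lt i : (cyc_succ i < n)%N. Proof. by rewrite ltn_mod; lia. Qed.
Lemma cyc_pred_lt i : (cyc_pred i < n)%N. Proof. by rewrite ltn_mod; lia. Qed.

Lemma cyc_succE i : (i < n)%N -> cyc_succ i = if i.+1 == n then 0%N else i.+1.
Proof. by move=> hi; rewrite /cyc_succ; case: eqP => [->|h]; rewrite ?modnn // modn_small; lia. Qed.

Lemma cyc_predE i : (i < n)%N -> cyc_pred i = if i == 0%N then n.-1 else i.-1.
Proof.
move=> hi; rewrite /cyc_pred; case: eqP => [->|h]; first by rewrite modn_small; lia.
have -> : (i + n.-1 = i.-1 + n)%N by lia.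
by rewrite modnDr modn_small; lia.
Qed.

(** For [n = 2] successor and predecessor coincide, and the two last terms add up to the entry
    -2. *)
Lemma cartanE i j : (i < n)%N -> (j < n)%N ->
  cartan n i j = 2 * (j == i)%:Z - (j == cyc_succ i)%:Z - (j == cyc_pred i)%:Z.
Proof.
move=> hi hj; rewrite /cartan cyc_succE // cyc_predE // (modn_small hi) (modn_small hj).
have e1 : (i.+1 %% n)%N = if i.+1 == n then 0%N else i.+1 by rewrite -cyc_succE.
have e2 : (j.+1 %% n)%N = if j.+1 == n then 0%N else j.+1 by rewrite -cyc_succE.
rewrite e1 e2.
by repeat case: eqP => /=; lia.
Qed.

Lemma cartan_sym i j : cartan n i j = cartan n j i.
Proof. by rewrite /cartan eq_sym [X in - X]addrC. Qed.

Lemma sum_delta (m : nat -> int) (j : nat) : (j < n)%N ->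
  \sum_(0 <= i < n) (i == j)%:Z * m i = m j.
Proof.
move=> hj; rewrite (bigD1_seq j) ?iota_uniq ?mem_index_iota //= eqxx mul1r.
by rewrite big1 ?addr0 // => i /negPf->; rewrite mul0r.
Qed.

Lemma cartan_sum (m : nat -> int) (j : nat) : (j < n)%N ->
  \sum_(0 <= i < n) cartan n j i * m i = 2 * m j - m (cyc_succ j) - m (cyc_pred j).
Proof.
move=> hj.
rewrite -(sum_delta m hj) -(sum_delta m (cyc_succ_lt j)) -(sum_delta m (cyc_pred_lt j)).
rewrite mulr_sumr -!sumrB; apply: eq_big_nat => i hi.
by rewrite cartanE // ; lia.
Qed.

(** Maximum principle: where [y] attains [M], both neighbours are at most [M] and sum to at least
    [2 M], so both equal [M]; the value then spreads along successors. *)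
Lemma cycle_const (y : nat -> int) (M : int) :
    (forall i, (i < n)%N -> y i <= M) -> (exists2 i, (i < n)%N & y i = M) ->
    (forall i, (i < n)%N -> y i = M -> 2 * M <= y (cyc_succ i) + y (cyc_pred i)) ->
  forall i, (i < n)%N -> y i = M.
Proof.
move=> hM [i0 hi0 yi0] hy.
have step k : y ((i0 + k) %% n)%N = M.
  elim: k => [|k IHk]; first by rewrite addn0 modn_small.
  have -> : ((i0 + k.+1) %% n = cyc_succ ((i0 + k) %% n))%N.
    by rewrite /cyc_succ addnS -addn1 -[in RHS]addn1 modnDml.
  have lt : ((i0 + k) %% n < n)%N by rewrite ltn_mod; lia.
  have := hy _ lt IHk; have := hM _ (cyc_succ_lt ((i0 + k) %% n)).
  by have := hM _ (cyc_pred_lt ((i0 + k) %% n)); lia.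
move=> i hi; rewrite -(step (n - i0 + i)%N).
have -> : (i0 + (n - i0 + i) = i + n)%N by lia.
by rewrite modnDr modn_small.
Qed.

End Cycle.

Lemma exists_argmax (n : nat) (y : nat -> int) : (0 < n)%N ->
  exists2 i, (i < n)%N & forall j, (j < n)%N -> y j <= y i.
Proof.
elim: n => [//|[|n] IHn] _.
  by exists 0%N => // j; case: j.
have [//|i hi hmax] := IHn; have [h|h] := lerP (y i) (y n.+1).
  exists n.+1 => // j; rewrite ltnS leq_eqVlt => /orP[/eqP->//|hj].
  exact: le_trans (hmax j hj) h.
exists i; first exact: ltnW.
by move=> j; rewrite ltnS leq_eqVlt => /orP[/eqP->|/hmax//]; exact: ltW.
Qed.

(* [None] stands for [d] and [Some i] for [h_i]. *)
Definition weight_val (n : nat) (o : option 'I_n) (mu : weight n) : int :=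
  if o is Some i then mu.1 i else mu.2.

Lemma weight_val_zmod_morphism n (o : option 'I_n) : zmod_morphism (weight_val o).
Proof. by case: o => [i|] mu nu //=; rewrite !ffunE. Qed.

HB.instance Definition _ (n : nat) (o : option 'I_n) :=
  GRing.isZmodMorphism.Build (weight n) int (weight_val o)
    (@weight_val_zmod_morphism n o).

Lemma weight_ext n (mu nu : weight n) :
  (forall o, weight_val o mu = weight_val o nu) -> mu = nu.
Proof.
move=> h; rewrite [mu]surjective_pairing [nu]surjective_pairing.
by congr (_, _); [apply/ffunP => i; exact: (h (Some i))|exact: (h None)].
Qed.

Section Weights.

Variables (n : nat) (n_gt1 : (1 < n)%N) (La : weight n).

(** Only the values of [m] below [n] matter. They may be negative, so that adding the null root
    stays within this form. *)
Definition subweight (m : nat -> int) : weight n :=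
  La - \sum_(0 <= i < n) simple_root n i *~ m i.

Lemma eq_subweight (m m' : nat -> int) :
  (forall i, (i < n)%N -> m i = m' i) -> subweight m = subweight m'.
Proof.
by move=> h; congr (_ - _); apply: eq_big_nat => i hi; rewrite h.
Qed.

Lemma subweight_h (m : nat -> int) (j : 'I_n) :
  (subweight m).1 j = La.1 j - 2 * m j + m (cyc_succ n j) + m (cyc_pred n j).
Proof.
have -> : (subweight m).1 j = La.1 j - \sum_(0 <= i < n) cartan n j i * m i.
  rewrite -[LHS]/(weight_val (Some j) _) raddfB raddf_sum; congr (_ - _).
  by apply: eq_bigr => i _; rewrite raddfMz /= ffunE mulrzz.
by rewrite cartan_sum //; lia.
Qed.

Lemma subweight_d (m : nat -> int) : (subweight m).2 = La.2 - m 0%N.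
Proof.
rewrite -[LHS]/(weight_val None _) raddfB raddf_sum; congr (_ - _).
rewrite -(@sum_delta n m 0); last by lia.
by apply: eq_bigr => i _; rewrite raddfMz /= mulrzz.
Qed.

Lemma subweight0 : subweight (fun=> 0) = La.
Proof. by rewrite /subweight big1 ?subr0 // => i _; rewrite mulr0z. Qed.

Lemma subweight_add_root (m : nat -> int) (i : nat) (z : int) : (i < n)%N ->
  subweight (fun j => m j + (j == i)%:Z * z) = subweight m - simple_root n i *~ z.
Proof.
move=> hi; rewrite /subweight -addrA -opprD; congr (_ - _).
under eq_bigr => j _ do rewrite mulrzDr.
rewrite big_split /=; congr (_ + _).
rewrite (bigD1_seq i) ?iota_uniq ?mem_index_iota //= eqxx mul1r.
by rewrite big1 ?addr0 // => j /negPf->; rewrite mul0r mulr0z.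
Qed.

Lemma subweight_add_null_root (m : nat -> int) :
  subweight m + null_root n = subweight (fun j => m j - 1).
Proof.
rewrite /subweight /null_root -addrA; congr (_ + _).
under [in RHS]eq_bigr => j _ do rewrite mulrzBr.
by rewrite sumrB opprB addrC.
Qed.

(** Equal values at all [h_i] make [m - m'] harmonic on the cycle, hence constant; the value at [d]
    shows that the constant is 0. *)
Lemma subweight_inj (m m' : nat -> int) : subweight m = subweight m' ->
  forall i, (i < n)%N -> m i = m' i.
Proof.
move=> hm.
have [i0 hi0 hmax] := exists_argmax (fun i => m i - m' i) (ltnW n_gt1).
have hc : forall i, (i < n)%N -> m i - m' i = m i0 - m' i0.
  apply: (cycle_const n_gt1 hmax); first by exists i0.
  move=> i hi hM; have := congr1 (fun w : weight n => w.1 (Ordinal hi)) hm.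
  by rewrite !subweight_h /=; lia.
have := congr1 snd hm; rewrite !subweight_d; have := hc 0%N ltac:(lia) => h0 h1.
by move=> i hi; have := hc i hi; lia.
Qed.

(** The sum is the level, the value at the central element [h_0 + ... + h_(n-1)], on which every
    simple root vanishes. *)
Lemma subweight_level (m : nat -> int) :
  \sum_j (subweight m).1 j = \sum_j La.1 j.
Proof.
have hT i : (i < n)%N -> \sum_(j < n) cartan n j i = 0.
  move=> hi; under eq_bigr => j _ do rewrite cartan_sym -[cartan _ _ _]mulr1.
  rewrite -(big_mkord xpredT (fun j => cartan n i j * 1)).
  by rewrite (@cartan_sum n n_gt1 (fun=> 1)).
have -> : \sum_j (subweight m).1 j =
    \sum_j (La.1 j - \sum_(0 <= i < n) cartan n j i * m i).
  apply: eq_bigr => j _; rewrite -[LHS]/(weight_val (Some j) _) raddfB raddf_sum.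
  congr (_ - _); apply: eq_bigr => i _; rewrite raddfMz /= ffunE mulrzz //.
rewrite sumrB exchange_big /= [X in _ - X]big_nat [X in _ - X]big1 ?subr0 // => i hi.
by rewrite -mulr_suml hT ?mul0r.
Qed.

End Weights.

(** * Weights of an integrable highest weight module *)

Section Module.

Variables (n : nat) (n_gt1 : (1 < n)%N).
Variables (K : fieldType) (charK0 : [pchar K] =i pred0).
Variables (g : lieAlgType K) (e f h : 'I_n -> g) (d : g).
Hypothesis hg : affine_sl e f h d.
Variables (V : lmodType K) (act : g -> V -> V) (La : weight n).
Hypothesis hV : is_V e f h d act La.

Local Notation wspace := (weight_space h d act).
Local Notation is_wt := (is_weight h d act).

Let hM : is_lie_module act. Proof. by case: hV. Qed.

Let actDr x u v : act x (u + v) = act x u + act x v.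
Proof. by rewrite -[u]scale1r (act_linearr hM) !scale1r. Qed.

Let act0r x : act x 0 = 0.
Proof. by apply: (addrI (act x 0)); rewrite -actDr !addr0. Qed.

Let actZr x c u : act x (c *: u) = c *: act x u.
Proof. by rewrite -[c *: u]addr0 (act_linearr hM) act0r addr0. Qed.

Let act0l v : act 0 v = 0.
Proof.
have := act_linearl hM (-1) 0 0 v; rewrite scaler0 addr0 scaleN1r addNr.
by [].
Qed.

Let actZl c x v : act (c *: x) v = c *: act x v.
Proof. by rewrite -[c *: x]addr0 (act_linearl hM) act0l addr0. Qed.

Let act_comm x y v : act x (act y v) = act (lie x y) v + act y (act x v).
Proof. by rewrite (act_lie hM) subrK. Qed.

Definition cartan_elt (o : option 'I_n) : g := if o is Some i then h i else d.

Lemma weight_spaceP mu v : wspace mu v <->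
  forall o, act (cartan_elt o) v = (weight_val o mu)%:~R *: v.
Proof.
split=> [[h1 h2] [i|]|hv]; first exact: h1.
  exact: h2.
by split=> [i|]; [exact: (hv (Some i))|exact: (hv None)].
Qed.

Lemma act_root_vector x (al : weight n) mu v :
    (forall o, lie (cartan_elt o) x = (weight_val o al)%:~R *: x) ->
  wspace mu v -> wspace (mu + al) (act x v).
Proof.
move=> hx /weight_spaceP hv; apply/weight_spaceP => o.
by rewrite act_comm hx hv actZl actZr -scalerDl raddfD intrD [RHS]/= addrC.
Qed.

Lemma act_e (i : 'I_n) mu v : wspace mu v -> wspace (mu + simple_root n i) (act (e i) v).
Proof.
apply: act_root_vector => -[j|] /=; first by rewrite ffunE (affine_sl_he hg).
by rewrite (affine_sl_de hg).
Qed.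

Lemma act_f (i : 'I_n) mu v : wspace mu v -> wspace (mu - simple_root n i) (act (f i) v).
Proof.
apply: act_root_vector => -[j|] /=.
  by rewrite !ffunE (affine_sl_hf hg) mulrNz.
by rewrite (affine_sl_df hg) mulrNz.
Qed.

Section HighestWeightVector.

Variable v0 : V.
Hypothesis v0_weight : wspace La v0.
Hypothesis v0_e : forall i, act (e i) v0 = 0.

(** Monomials in the [f_i] applied to [v0], indexed by how often each [f_i] occurs. The factor 1
    matches [subweight_add_root] with [z = 1]. *)
Inductive f_word : (nat -> int) -> V -> Prop :=
| f_word_nil : f_word (fun=> 0) v0
| f_word_cons m (i : 'I_n) v :
    f_word m v -> f_word (fun j => m j + (j == i :> nat)%:Z * 1) (act (f i) v).

Inductive f_span : V -> Prop :=
| f_span0 : f_span 0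
| f_span_cons c m w u : f_word m w -> f_span u -> f_span (c *: w + u).

Lemma f_word_weight m w : f_word m w -> wspace (subweight La m) w.
Proof.
elim=> [|{}m i v hv IHv]; first by rewrite subweight0.
by rewrite subweight_add_root // mulr1z; exact: act_f.
Qed.

Lemma f_word_ge0 m w : f_word m w -> forall i, 0 <= m i.
Proof. by elim=> // {}m i v _ IHm j; have := IHm j; lia. Qed.

Lemma f_span_word m w : f_word m w -> f_span w.
Proof. by move=> /(f_span_cons 1)/(_ f_span0); rewrite scale1r addr0. Qed.

Lemma f_span_subspace : is_subspace f_span.
Proof.
split=> [|c u v hu hv]; first exact: f_span0.
elim: hu => [|c' m w u' hw hu' IHu]; first by rewrite scaler0 add0r.
by rewrite scalerDr scalerA -addrA; exact: (f_span_cons _ hw).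
Qed.

Lemma f_spanZ c u : f_span u -> f_span (c *: u).
Proof.
move=> hu; rewrite -[_ *: _]addr0.
exact: (f_span_subspace.2 c _ _ hu f_span0).
Qed.

Lemma f_spanD u v : f_span u -> f_span v -> f_span (u + v).
Proof. by move=> hu hv; rewrite -[u]scale1r; exact: f_span_subspace.2. Qed.

Lemma f_span_act x : (forall m w, f_word m w -> f_span (act x w)) ->
  forall u, f_span u -> f_span (act x u).
Proof.
move=> hx u; elim=> [|c m w {}u hw hu IHu]; first by rewrite act0r; exact: f_span0.
by rewrite (act_linearr hM); apply: f_span_subspace.2; [exact: hx hw|].
Qed.

Lemma f_span_cartan o u : f_span u -> f_span (act (cartan_elt o) u).
Proof.
apply: f_span_act => m w hw; rewrite ((weight_spaceP _ _).1 (f_word_weight hw)).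
exact: f_spanZ (f_span_word hw).
Qed.

Lemma f_span_f i u : f_span u -> f_span (act (f i) u).
Proof.
by apply: f_span_act => m w hw; exact: f_span_word (f_word_cons i hw).
Qed.

(** The bracket of [e_i] and [f_j] is 0 or [h_i], so [e_i] moves through a word until it reaches
    [v0], which it kills. *)
Lemma f_span_e i u : f_span u -> f_span (act (e i) u).
Proof.
apply: f_span_act => m w; elim=> [|{}m j v hv IHv]; first by rewrite v0_e; exact: f_span0.
rewrite act_comm (affine_sl_ef hg) actZl; apply: f_spanD; last exact: f_span_f.
by apply: f_spanZ; exact: (f_span_cartan (Some i) (f_span_word hv)).
Qed.

Lemma f_span_submodule : is_submodule act f_span.
Proof.
split; first exact: f_span_subspace.
(* The elements that preserve the span form a subalgebra containing all generators, hence all of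
   [g]. *)
pose A : set g := [set x | forall u, f_span u -> f_span (act x u)].
have subA : is_subalgebra A.
  split; first split.
  - by move=> u _; rewrite act0l; exact: f_span0.
  - move=> c x y hx hy u hu; rewrite (act_linearl hM).
    by apply: f_span_subspace.2; [exact: hx|exact: hy].
  - move=> x y hx hy u hu; rewrite (act_lie hM) -scaleN1r addrC.
    by apply: f_span_subspace.2; [apply/hy/hx|apply/hx/hy].
have AT : A = setT.
  apply: (affine_sl_gen hg subA) => [i|]; last by move=> u; exact: (f_span_cartan None).
  by split=> u; [exact: f_span_e|exact: f_span_f|exact: (f_span_cartan (Some i))].
by move=> x; have : A x by rewrite AT.
Qed.

(* [D] is a product of operators [x - c] with [x] in the Cartan subalgebra, one
   for each weight occurring in [u]. *)
Lemma f_span_annihilator mu u :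
    (forall m, (forall i, 0 <= m i) -> mu <> subweight La m) -> f_span u ->
  exists D : V -> V, [/\ forall c v w, D (c *: v + w) = c *: D v + D w, D u = 0 &
    forall nu, exists2 c : K, (nu = mu -> c != 0) & forall v, wspace nu v -> D v = c *: v].
Proof.
move=> hmu; elim=> [|c m w {}u hw hu [D [linD Du Dw]]].
  exists id; split=> // nu; exists 1; first by rewrite oner_neq0.
  by move=> v _; rewrite scale1r.
have [o ho] : exists o, weight_val o mu != weight_val o (subweight La m).
  apply: contrapT => no; apply: (hmu m (f_word_ge0 hw)); apply: weight_ext => o.
  by apply/eqP; apply/negPn/negP => ho; apply: no; exists o.
have hww := (weight_spaceP _ _).1 (f_word_weight hw).
pose a : K := (weight_val o (subweight La m))%:~R.
exists (fun v => act (cartan_elt o) (D v) - a *: D v); split.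
- move=> c' v v'; rewrite linD (act_linearr hM) !scalerDr !scalerN !scalerA [a * c']mulrC.
  by rewrite opprD addrACA.
- have [c' _ hc'] := Dw (subweight La m).
  rewrite linD Du addr0 (hc' _ (f_word_weight hw)) !actZr hww -/a.
  by rewrite !scalerA -scalerBl -!mulrA [a * _]mulrC -mulrA subrr scale0r.
- move=> nu; have [c' c'0 hc'] := Dw nu.
  (* The new factor scales weight [nu] by a difference of integers; for [nu = mu] it is nonzero by
     the choice of [o], also in [K] by characteristic 0. *)
  exists (((weight_val o nu)%:~R - a) * c').
    move=> enu; rewrite mulf_neq0 ?c'0 // enu /a -intrB intr_char0_eq0 //.
    by rewrite subr_eq0.
  move=> v hv; rewrite hc' // actZr ((weight_spaceP _ _).1 hv) !scalerA -scalerBl.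
  by rewrite mulrBl [c' * _]mulrC.
Qed.

End HighestWeightVector.

(** The words in the [f_i] span [V]. If [mu] had another form, the operator of [f_span_annihilator]
    would both kill a nonzero vector of weight [mu] and multiply it by a nonzero scalar. *)
Lemma weight_le mu : is_wt mu ->
  exists2 m, (forall i : nat, 0 <= m i) & mu = subweight La m.
Proof.
move=> [u u0 hu]; apply: contrapT => hn.
have hmu m : (forall i, 0 <= m i) -> mu <> subweight La m.
  by move=> m0 em; apply: hn; exists m.
have [_ [v0 [_ v0w v0e v0gen]] _] := hV.
have spanT := v0gen _ (f_span_submodule v0w v0e) (f_span_word (f_word_nil v0)).
have su : f_span v0 u by have : setT u by []; rewrite -spanT.
have [D [_ Du /(_ mu) [c c0 hc]]] := f_span_annihilator v0w hmu su.
move: Du; rewrite hc // => /eqP; rewrite scaler_eq0 (negPf u0) orbF.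
by apply/negP; exact: c0.
Qed.

Lemma is_weight_highest : is_wt La.
Proof. by have [_ [v0 [v00 v0w _ _]] _] := hV; exists v0. Qed.

(** An sl(2) argument: if [f_i v = 0], then [f_i e_i^(j+1) v = -(j + 1)(mu(h_i) + j) e_i^j v] with a
    nonzero coefficient, so no power of [e_i] kills [v], against integrability. *)
Lemma is_weight_sub_root mu (i : 'I_n) :
  is_wt mu -> 0 < mu.1 i -> is_wt (mu - simple_root n i).
Proof.
move=> [v v0 hv] mu0; exists (act (f i) v); last exact: act_f.
apply/eqP => fv0.
have he j : wspace (mu + simple_root n i *~ j%:Z) (iter j (act (e i)) v).
  elim: j => [|j IHj] /=; first by rewrite mulr0z addr0.
  by rewrite -[j.+1]addn1 PoszD mulrzDr mulr1z addrA; exact: act_e.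
have hh j : act (h i) (iter j (act (e i)) v) =
    (mu.1 i + 2 * j%:Z)%:~R *: iter j (act (e i)) v.
  have [/(_ i) -> _] := he j; congr (_%:~R *: _).
  rewrite -[LHS]/(weight_val (Some i) _) raddfD raddfMz /= ffunE /cartan eqxx.
  by rewrite mulrzz.
have hf j : act (f i) (iter j.+1 (act (e i)) v) =
    (- (j.+1%:Z * (mu.1 i + j%:Z)))%:~R *: iter j (act (e i)) v.
  have ef u : act (f i) (act (e i) u) = act (e i) (act (f i) u) - act (h i) u.
    by rewrite [act (e i) (act _ _)]act_comm (affine_sl_ef hg) eqxx scale1r addrC addKr.
  elim: j => [|j IHj].
    rewrite /= ef fv0 act0r sub0r.
    have /= -> := hh 0%N; rewrite -scaleNr; congr (_ *: _).
    by rewrite mulr0 addr0 mul1r mulrNz.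
  rewrite iterS ef IHj actZr hh -iterS -scalerBl -intrB; congr (_%:~R *: _).
  lia.
have [_ _ /(_ i v) [N [hN _]]] := hV.
suff : forall j, iter j (act (e i)) v != 0 by move=> /(_ N); rewrite hN eqxx.
elim=> [//|j IHj]; apply/eqP => ej.
have := hf j; rewrite ej act0r => /esym/eqP; rewrite scaler_eq0 (negPf IHj) orbF.
by rewrite intr_char0_eq0 //; lia.
Qed.

(* Kac, Proposition 11.2: among the weights [La - c] with [c <= m], one that
   cannot be lowered towards [m] has [m - c] subharmonic on the cycle, hence
   constant; if [c] differed from [m] the weight would have level at most 0. *)
Lemma dominant_is_weight (m : nat -> int) :
    (forall i, (i < n)%N -> 0 <= m i) -> 0 < \sum_j La.1 j ->
  dominant n (subweight La m) -> is_wt (subweight La m).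
Proof.
move=> m0 lev dom.
suff main N (c : nat -> int) : (forall i, (i < n)%N -> c i <= m i) ->
    is_wt (subweight La c) -> \sum_(i < n) (m i - c i) = N%:Z -> is_wt (subweight La m).
  have := main (absz (\sum_(i < n) m i)) (fun=> 0); apply => //.
    by rewrite subweight0; exact: is_weight_highest.
  under eq_bigr => i _ do rewrite subr0.
  by rewrite gez0_abs // sumr_ge0 // => i _; exact: m0.
elim: N c => [|N IHN] c cm wc hN.
  have mc i : (i < n)%N -> c i = m i.
    move=> hi; have /eqP := hN; rewrite psumr_eq0; last by move=> j _; rewrite subr_ge0 cm.
    by move=> /allP /(_ (Ordinal hi) (mem_index_enum _)) /= /eqP; lia.
  by rewrite -(eq_subweight La mc).
have [[i [ci hi]]|hno] := pselect (exists i : 'I_n, c i < m i /\ 0 < (subweight La c).1 i).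
  apply: (IHN (fun j => c j + (j == i)%:Z * 1)).
  - move=> j hj; have := cm j hj; case: eqP => [->|_]; lia.
  - by rewrite subweight_add_root // mulr1z; exact: is_weight_sub_root.
  - have -> : \sum_(j < n) (m j - (c j + (j == i :> nat)%:Z * 1)) =
        \sum_(j < n) (m j - c j) - \sum_(j < n) (j == i :> nat)%:Z * 1.
      by rewrite -sumrB; apply: eq_bigr => j _; lia.
    rewrite hN -(big_mkord xpredT (fun j => (j == i)%:Z * 1)) (sum_delta (fun=> 1)) //.
    lia.
exfalso.
have [i0 hi0 hmax] := exists_argmax (fun i => m i - c i) (ltnW n_gt1).
have y0 : 0 < m i0 - c i0.
  rewrite ltNge; apply/negP => y0.
  have : \sum_(i < n) (m i - c i) <= 0.
    by apply: sumr_le0 => i _; exact: le_trans (hmax i (ltn_ord i)) y0.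
  by rewrite hN.
have hle i (hi : (i < n)%N) : 0 < m i - c i -> (subweight La c).1 (Ordinal hi) <= 0.
  move=> yi; rewrite leNgt; apply/negP => hp; apply: hno; exists (Ordinal hi).
  by split=> //=; rewrite -subr_gt0.
have hc : forall i, (i < n)%N -> m i - c i = m i0 - c i0.
  apply: (cycle_const n_gt1 hmax); first by exists i0.
  (* At a maximum of [m - c] the weight for [c] is at most 0 at [h_i] and the weight for [m] at
     least 0; their difference there is the Laplacian of [m - c]. *)
  move=> i hi hy; have := hle i hi; rewrite hy => /(_ y0).
  by have := dom (Ordinal hi); rewrite !subweight_h /=; lia.
move: lev; rewrite -(subweight_level n_gt1 La c) ltNge => /negP; apply.
by apply: sumr_le0 => -[i hi] _; apply: hle; rewrite hc.
Qed.

(** Adding the null root lowers every [m_i] by 1 and keeps the weight dominant. The result is a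
    weight when all [m_i] are positive, by [dominant_is_weight], and is not one when some [m_i] is
    0, by [weight_le] and uniqueness of [m]. *)
Lemma max_dominantP (mu : weight n) : 0 < \sum_j La.1 j ->
  (max_weights h d act `&` dominant n) mu <->
  exists m : nat -> int, [/\ forall i, (i < n)%N -> 0 <= m i,
    exists2 i, (i < n)%N & m i = 0, mu = subweight La m & dominant n mu].
Proof.
move=> lev; split.
  move=> [[/weight_le[m m0 ->] nmu] dom]; exists m; split=> //.
  apply: contrapT => hno; apply: nmu; rewrite subweight_add_null_root.
  apply: dominant_is_weight => //.
    move=> i hi; rewrite subr_ge0; have := m0 i; rewrite le_eqVlt => /orP[/eqP e0|//].
    by case: hno; exists i.
  by move=> i; have := dom i; rewrite !subweight_h //; lia.
move=> [m [m0 [i hi mi] -> dom]]; split=> //; split; first exact: dominant_is_weight.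
rewrite subweight_add_null_root => /weight_le[m' m'0 /(subweight_inj n_gt1) /(_ i hi)].
by rewrite mi; have := m'0 i; lia.
Qed.

End Module.

(** * Weights of tuples *)

Section TupleWeights.

Variables (n k s : nat) (n_gt1 : (1 < n)%N) (k_gt1 : (1 < k)%N) (sn : (s < n)%N).
Implicit Type x : n.-1.-tuple nat.

Definition max_entry x : nat := (\max_(y <- x) y)%N.

Lemma max_entry_ge x i : ext x i <= max_entry x.
Proof.
rewrite /ext; case: eqP => // /eqP i0; rewrite lez_nat /ent.
have [hi|hi] := ltnP i.-1 (size x); last by rewrite nth_default.
by apply: leq_bigmax_seq => //; apply: mem_nth.
Qed.

Lemma max_entry_attained x : exists2 i, (i < n)%N & ext x i = max_entry x.
Proof.
have [|y ymax] := @bigop.eq_bigmax _ (tnth x); first by rewrite card_ord; lia.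
exists y.+1; first by have := ltn_ord y; lia.
rewrite -entE // /ent /= -tnth_nth -ymax; congr (_%:Z).
by rewrite /max_entry big_tuple.
Qed.

Lemma Lambda_h (j : 'I_n) :
  (Lambda n k s).1 j = (j == 0%N :> nat)%:Z * k.-1%:Z + (j == s :> nat)%:Z.
Proof.
rewrite -[LHS]/(weight_val (Some j) _) raddfD raddfMn /= !ffunE.
by rewrite -mulr_natr natz.
Qed.

Lemma Lambda_level : 0 < \sum_j (Lambda n k s).1 j.
Proof.
rewrite (bigD1 (Ordinal (ltnW n_gt1))) //= ltr_wpDr //.
  by apply: sumr_ge0 => i _; rewrite Lambda_h; lia.
by rewrite Lambda_h /=; lia.
Qed.

Lemma tuple_weightE x :
  tuple_weight k s x = subweight (Lambda n k s) (fun i => (max_entry x)%:Z - ext x i).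
Proof.
rewrite /tuple_weight /subweight [in RHS]big_ltn; last by lia.
rewrite ext0 subr0 opprD addrA; congr (_ - _ - _).
by apply: eq_big_nat => i hi; rewrite entE //; lia.
Qed.

(** The condition at [h_i] with [0 < i] is almost concavity at [i]; the one at [h_0], whose
    neighbours on the cycle are 1 and [n - 1], is the bound on the end entries. *)
Lemma tuple_weight_dominant x : dominant n (tuple_weight k s x) <->
  almost_concave s x /\ (ent x 1 + ent x n.-1 <= k.-1 + (s == 0))%N.
Proof.
have hd (j : 'I_n) : (tuple_weight k s x).1 j =
    (j == 0%N :> nat)%:Z * k.-1%:Z + (j == s :> nat)%:Z
      + 2 * ext x j - ext x (cyc_succ n j) - ext x (cyc_pred n j).
  by rewrite tuple_weightE subweight_h // Lambda_h; lia.
have extn i : (0 < i <= n)%N -> ext x (if i == n then 0%N else i) = ext x i.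
  by move=> hi; case: eqP => [->|//]; rewrite ext_n.
have e1 : (ent x 1)%:Z = ext x 1 by rewrite entE.
have en : (ent x n.-1)%:Z = ext x n.-1 by rewrite entE //; lia.
split=> [dom|[hx hk] j].
  split=> [i hi|].
    have hi' : (i < n)%N by lia.
    have := dom (Ordinal hi'); rewrite hd /= cyc_succE // cyc_predE // extn //.
    have -> : (i == 0)%N = false by lia.
    by lia.
  have := dom (Ordinal (ltnW n_gt1)); rewrite hd /= cyc_succE ?cyc_predE ?(ltnW n_gt1) //=.
  rewrite extn ?ext0; last by lia.
  by rewrite [(s == 0)%N]eq_sym -lez_nat; lia.
rewrite hd cyc_succE // cyc_predE // extn; last by have := ltn_ord j; lia.
have [j0|j0] := eqVneq (j : nat) 0%N.
  by rewrite j0 ext0; move: hk; rewrite [(s == 0)%N]eq_sym -lez_nat; lia.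
by have := hx j ltac:(have := ltn_ord j; lia); lia.
Qed.

(** Used for nonnegative [X] with [X 0 = 0], where [absz] loses nothing. *)
Definition ffun_tuple (X : nat -> int) : n.-1.-tuple nat := [tuple absz (X i.+1) | i < n.-1].

Lemma ext_ffun_tuple (X : nat -> int) i : X 0%N = 0 ->
  (forall i, (i < n)%N -> 0 <= X i) -> (i < n)%N -> ext (ffun_tuple X) i = X i.
Proof.
move=> X0 hX hi; have [->|i0] := posnP i; first by rewrite ext0.
rewrite -entE // /ent.
have hi' : (i.-1 < n.-1)%N by lia.
rewrite -[i.-1]/(nat_of_ord (Ordinal hi')) -tnth_nth tnth_mktuple /=.
by rewrite prednK // gez0_abs // hX.
Qed.

(** The tuple is [x_i = m_0 - m_i]. Dominance makes it almost concave, hence nonnegative, and the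
    vanishing of some [m_i] makes its largest entry [m_0]. *)
Lemma weights_tuple (mu : weight n) : dominant n mu ->
  (exists m : nat -> int, [/\ forall i, (i < n)%N -> 0 <= m i,
    exists2 i, (i < n)%N & m i = 0 & mu = subweight (Lambda n k s) m]) <->
  exists x, mu = tuple_weight k s x.
Proof.
move=> dom; split=> [[m [m0 [z hz mz] emu]]|[x ->]]; last first.
  exists (fun i => (max_entry x)%:Z - ext x i); split; last exact: tuple_weightE.
    by move=> i _; rewrite subr_ge0 max_entry_ge.
  by have [i hi ei] := max_entry_attained x; exists i; rewrite // ei subrr.
(* Position [n] stands for vertex 0 of the cycle again, which gives the value 0. *)
pose X : nat -> int := fun i => if i == n then 0 else m 0%N - m i.
have X0 : X 0%N = 0 by rewrite /X subrr; case: eqP.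
have Xn : X n = 0 by rewrite /X eqxx.
have XE i : (i < n)%N -> X i = m 0%N - m i by move=> hi; rewrite /X; case: eqP => //; lia.
have hX i : (i < n)%N -> 0 <= X i.
  move=> hi; apply: (almost_concave_ge0 sn X0 Xn); last by lia.
  move=> {hi}i hi; have hi' : (i < n)%N by lia.
  have := dom (Ordinal hi'); rewrite emu subweight_h // Lambda_h /= cyc_succE // cyc_predE //.
  have -> : (i == 0)%N = false by lia.
  rewrite mul0r (XE i) // (XE i.-1); last by lia.
  by rewrite /X; case: (i.+1 =P n) => _; lia.
exists (ffun_tuple X); rewrite emu tuple_weightE; apply: eq_subweight => i hi.
rewrite (ext_ffun_tuple X0 hX hi) XE //.
suff -> : (max_entry (ffun_tuple X))%:Z = m 0%N by lia.
apply/eqP; rewrite eq_le; apply/andP; split.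
  have [j hj <-] := max_entry_attained (ffun_tuple X).
  by rewrite (ext_ffun_tuple X0 hX hj) XE //; have := m0 j hj; lia.
by have := max_entry_ge (ffun_tuple X) z; rewrite (ext_ffun_tuple X0 hX hz) XE // mz subr0.
Qed.

Lemma tuple_weight_eq0 x : (forall i, ext x i <= 0) -> tuple_weight k s x = Lambda n k s.
Proof.
move=> hx; rewrite tuple_weightE -[RHS]subweight0; apply: eq_subweight => i hi.
have [j _ <-] := max_entry_attained x.
by have := hx i; have := hx j; have := ext_ge0 x i; have := ext_ge0 x j; lia.
Qed.

Lemma bigcup_all_M (mu : weight n) :
  (W k s (M1 n s) `|` W k s (M2 n s) `|` W k s (M3 n s) `|` W k s (M4 n s)
    `|` W k s (M5 n s)) mu <->
  exists2 x, (exists2 y, end_pairs k s y & all_M s y.1 y.2 x) & mu = tuple_weight k s x.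
Proof.
split; last first.
  move=> [x [y hy hx] ->]; case: hx => [[[[hx|hx]|hx]|hx]|hx];
    [do 4 left|do 3 left; right|do 2 left; right|left; right|right]; exists x => //; by exists y.
by move=> [[[[|]|]|]|] [x [y hy hx] <-]; exists x => //; exists y => //;
  [do 4 left|do 3 left; right|do 2 left; right|left; right|right].
Qed.

End TupleWeights.

(** * The maximal dominant weights *)

Theorem theorem3p5 (n k s : nat) (hn : (2 <= n)%N) (hk : (2 <= k)%N)
    (hs : (s <= n.-1)%N)
    (K : fieldType) (charK0 : [pchar K] =i pred0)
    (g : lieAlgType K) (e f h : 'I_n -> g) (d : g)
    (hg : affine_sl e f h d)
    (V : lmodType K) (act : g -> V -> V)
    (hV : is_V e f h d act (Lambda n k s)) :
  max_weights h d act `&` dominant n =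
  [set Lambda n k s] `|` W k s (M1 n s) `|` W k s (M2 n s) `|` W k s (M3 n s)
    `|` W k s (M4 n s) `|` W k s (M5 n s).
Proof.
have sn : (s < n)%N by lia.
rewrite -!setUA; apply/seteqP; split=> mu.
  move=> hmu; have [m [m0 mz emu dom]] :=
    (max_dominantP hn charK0 hg hV mu (Lambda_level hn hk sn)).1 hmu.
  have [x ex] := (weights_tuple hn hk sn dom).1 (ex_intro _ m (And3 m0 mz emu)).
  (* The zero tuple accounts for [Lambda] itself. *)
  have [[i xi]|hx0] := pselect (exists i, 0 < ext x i); last first.
    left; rewrite ex; apply: tuple_weight_eq0 => // i; rewrite leNgt; apply/negP => xi.
    by apply: hx0; exists i.
  right; rewrite !setUA; apply/bigcup_all_M.
  move: dom; rewrite ex => /(tuple_weight_dominant hn hk sn) [hx hends].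
  exists x => //; have hM := almost_concave_M hn sn hx (ex_intro _ i xi).
  (* For [s = 0] the end entries must be positive, which membership in M5 provides. *)
  exists (ent x 1, ent x n.-1) => //; split=> //=;
    by have [s0|] := posnP s => //; move: hM; rewrite s0 => /all_M0_ends_gt0[].
move=> hmu; apply/(max_dominantP hn charK0 hg hV _ (Lambda_level hn hk sn)).
case: hmu => [->|].
  exists (fun=> 0); split; rewrite ?subweight0 //; first by exists 0%N => //; lia.
  by move=> j; rewrite Lambda_h; lia.
rewrite !setUA => /bigcup_all_M [x [y [_ _ hy] hx] ->].
have dom : dominant n (tuple_weight k s x).
  apply/(tuple_weight_dominant hn hk sn); split; first exact: all_M_almost_concave hx.
  by have [-> ->] := all_M_ends hn hx.
have [m [m0 mz emu]] := (weights_tuple hn hk sn dom).2 (ex_intro _ x erefl).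
by exists m.
Qed.
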